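(* Let $G$ be a finite simple graph of maximum degree $d\ge 3$. Then there exists a signing $\sigma:E(G)\to\{-1,1\}$ such that \[ \rho(A_\sigma)\le 4\sqrt{\left\lceil\frac d2\right\rceil-1}. \] Consequently, this signing also satisfies \[ \rho(A_\sigma)\le 2\sqrt{2(d-1)}. \]
   Context: Graphs are undirected. For a graph $G=(V,E)$ and a signing $\sigma:E\to\{-1,1\}$ of its edges, the signed adjacency matrix $A_\sigma$ is the real symmetric matrix indexed by $V$ with $(A_\sigma)_{uv}=\sigma(uv)$ if $uv\in E$ and $(A_\sigma)_{uv}=0$ if $uv\notin E$. For a real symmetric matrix $M$, $\rho(M)=\max_i|\lambda_i(M)|$ denotes its spectral radius, where the $\lambda_i(M)$ are the eigenvalues of $M$. *)

(* Defs.v *)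
From mathcomp Require Import all_boot all_order all_algebra.
From mathcomp Require Import reals polyrcf.

Set Implicit Arguments.
Unset Strict Implicit.
Unset Printing Implicit Defensive.

Import Order.TTheory GRing.Theory Num.Theory.
Local Open Scope ring_scope.

Section Graph.
Variables (T : finType) (e : rel T).

Definition simple_graph : Prop := symmetric e /\ irreflexive e.

Definition degree (u : T) : nat := #|[set v | e u v]|.

Definition max_degree : nat := \max_(u : T) degree u.

Definition edges : {set {set T}} :=
  [set [set uv.1; uv.2] | uv in [set uv : T * T | e uv.1 uv.2]].

(* Values of sigma outside edges are irrelevant. Since the edge uv is the
   unordered pair [set u; v], sigma(uv) = sigma(vu) holds by construction. *)
Definition signing (sigma : {set T} -> int) : Prop :=
  forall E, E \in edges -> sigma E = -1 \/ sigma E = 1.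

(* Rows and columns are indexed by T through the bijection
   enum_val : 'I_#|T| -> T. *)
Definition signed_adjacency (R : realType) (sigma : {set T} -> int) :
    'M[R]_#|T| :=
  \matrix_(i, j) if e (enum_val i) (enum_val j)
                 then (sigma [set enum_val i; enum_val j])%:~R else 0.

End Graph.

Section SpectralRadius.
Variables (R : realType) (n : nat).

Definition eigenvalues (M : 'M[R]_n) : seq R := rootsR (char_poly M).

Lemma mem_eigenvalues (M : 'M[R]_n) (a : R) :
  (a \in eigenvalues M) = eigenvalue M a.
Proof.
have p0 : char_poly M != 0 by rewrite monic_neq0 ?char_poly_monic.
by rewrite eigenvalue_root_char -(roots_on_rootsR p0).
Qed.

(* Only real eigenvalues are considered: this is the spectral radius when M is
   symmetric, as all its eigenvalues are then real. Starting the maximum at 0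
   is harmless because absolute values are nonnegative. *)
Definition spectral_radius (M : 'M[R]_n) : R :=
  \big[Num.max/0]_(a <- eigenvalues M) `|a|.

End SpectralRadius.

Lemma signed_adjacency_sym (T : finType) (e : rel T) (R : realType)
    (sigma : {set T} -> int) :
  symmetric e -> (signed_adjacency e R sigma)^T = signed_adjacency e R sigma.
Proof. by move=> se; apply/matrixP=> i j; rewrite !mxE se setUC. Qed.

(* Main.v *)
Require Import Defs.
From mathcomp Require Import reals normedtype derive perm.
From mathcomp Require Import all_boot all_order all_algebra.
From mathcomp Require Import complex polyrcf ring lra zify.

Set Implicit Arguments.
Unset Strict Implicit.
Unset Printing Implicit Defensive.

Import Order.TTheory GRing.Theory Num.Theory.
Import numFieldNormedType.Exports.

(** Orient the edges of G so that in- and out-degrees are at most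
    k + 1, the ceiling of d / 2 ([balanced_graph_orientation]), and read each
    arc (u, v) as an edge between u in one copy of V and v in another.  The
    resulting bipartite graph H has maximum degree at most k + 1.  A signing of
    H is a matrix N indexed by V, with A_sigma = N + N^T for the corresponding
    signing of G, and the adjacency matrix of H has blocks 0, N, N^T, 0.  If
    all eigenvalues of the latter are at most l = 2 sqrt k, then testing the
    quadratic form on (v, v) and (v, -v) gives |v A_sigma v^T| <= 2 l |v|^2,
    which is the theorem ([oriented_signing]).

    So it suffices to find a signing of a graph of maximum degree k + 1 with no
    eigenvalue above 2 sqrt k ([bounded_degree_signing]).  This is the
    interlacing argument of Marcus, Spielman and Srivastava.  The sum of
    det(x - A_s) over all signings s is a multiple of the matching polynomial
    ([signsum_principal_minor_scalar], after Godsil and Gutman), which is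
    positive for x >= 2 sqrt k ([matching_sum_ratio], after Heilmann and Lieb).
    The signs are then fixed one at a time, keeping the sum over the remaining
    signs positive on [l, +oo[ ([above_roots_cons], [above_roots_signing]).

    Such a step is possible for the following reason.  Let F be the sum of
    determinants over the remaining signings, as a function of a matrix M.
    Adding sE to M, where E is the adjacency matrix of one edge uv and s a
    sign, is the same as subtracting w^T w from M + E_uu + E_vv, for
    w = e_u - s e_v.  Now F is affine along rank one directions
    ([signsum_rank1_affine]), like the determinant.  From this alone, by
    induction on the edges, F does not vanish where M has positive definite
    imaginary part ([signsum_upper_nonvanishing]).  Hence t |-> F(M + t) and
    t |-> F(M - w^T w + t) have a Wronskian of constant sign
    ([interlaced_rank1]), so that their quotient is monotone to the right of
    all the roots of the first one, and tends to 1.  Thus both polynomials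
    F(M + t -+ E) have the common interlacing polynomial F(M + E_uu + E_vv + t):
    it is positive as far down as their sum is, and then whichever of the two is
    positive at the left end stays positive to its right. *)

(** * Balanced orientations *)

Section Orientation.
Variable T : eqType.
Implicit Types (L : seq (T * T)) (v a b c : T).

Definition outdeg L v := count (fun p => p.1 == v) L.
Definition indeg L v := count (fun p => p.2 == v) L.

(** [L'] is [L] with some pairs swapped, up to order.  Counting unordered pairs
    makes this insensitive to the order of the lists; the second clause only
    keeps degrees at hand, a loop counting twice. *)
Definition reorients L L' :=
  (forall a b, count_mem (a, b) L' + count_mem (b, a) L' =
               count_mem (a, b) L + count_mem (b, a) L) /\
  (forall v, outdeg L' v + indeg L' v = outdeg L v + indeg L v).

Definition balanced L := forall v, outdeg L v <= (indeg L v).+1 /\ indeg L v <= (outdeg L v).+1.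

Lemma pair_swap_eq a b x y : ((a, b) == (x, y)) = ((b, a) == (y, x)).
Proof. by rewrite !xpair_eqE andbC. Qed.

Lemma count_rem_mem (P : pred (T * T)) L p : p \in L -> count P L = P p + count P (rem p L).
Proof. by move=> pL; rewrite (permP (perm_to_rem pL) P). Qed.

(** Splitting off: a balanced orientation of the multigraph where the path
    a - b - c is replaced by the single edge a - c gives one of the original
    multigraph, by routing that edge back through b.  The detour adds one
    incoming and one outgoing arc at b and changes nothing at a and c. *)
Lemma splice_orientation a b c L1 p M : p \in L1 -> p = (b, c) \/ p = (c, b) ->
  reorients ((a, c) :: rem p L1) M -> balanced M ->
  exists2 L', reorients ((a, b) :: L1) L' & balanced L'.
Proof.
move=> pL1 pbc [rM dM] bM.
have : (a, c) \in M \/ (c, a) \in M.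
  have := rM a c; rewrite /= eqxx -!has_pred1 !has_count.
  case: (count_mem (a, c) M) => [|k _]; last by left.
  by case: (count_mem (c, a) M) => [//|k _]; right.
have L1E := count_rem_mem _ pL1.
have swaps := (pair_swap_eq b a, pair_swap_eq c a, pair_swap_eq c b).
case=> acM; have ME := count_rem_mem _ acM;
  [exists [:: (a, b), (b, c) & rem (a, c) M] | exists [:: (c, b), (b, a) & rem (c, a) M]].
- split=> [x y|v].
    by have := rM x y; rewrite /= !L1E !ME; case: pbc => ->; rewrite /= ?swaps; lia.
  by have := dM v; rewrite /outdeg /indeg /= !L1E !ME; case: pbc => -> /=; lia.
- by move=> v; have := bM v; rewrite /outdeg /indeg /= !ME /=; lia.
- split=> [x y|v].
    by have := rM x y; rewrite /= !L1E !ME; case: pbc => ->; rewrite /= ?swaps; lia.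
  by have := dM v; rewrite /outdeg /indeg /= !L1E !ME; case: pbc => -> /=; lia.
- by move=> v; have := bM v; rewrite /outdeg /indeg /= !ME /=; lia.
Qed.

Lemma reorients_flip a b L L' : reorients ((b, a) :: L) L' -> reorients ((a, b) :: L) L'.
Proof.
move=> [r d]; split=> [x y|v].
  by rewrite r /= !(pair_swap_eq b a); lia.
by rewrite d /outdeg /indeg /=; lia.
Qed.

(** Loops and multiple edges are allowed because splitting off creates them.
    By induction on the number of edges: the first edge is put aside if it is a
    loop or meets no other edge, and is otherwise merged with an edge that it
    meets. *)
Lemma balanced_orientation L : exists2 L', reorients L L' & balanced L'.
Proof.
have [m] := ubnP (size L); elim: m L => // m IH [|[a b] L] /=; first by exists [::].
rewrite ltnS => sL.
have [L' [rL' dL'] bL'] := IH _ sL.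
have ext : (a == b) || ~~ has (fun p => [|| p.1 == a, p.2 == a, p.1 == b | p.2 == b]) L ->
   exists2 L'', reorients ((a, b) :: L) L'' & balanced L''.
  move=> H; exists ((a, b) :: L').
    split=> [x y|v] /=; first by rewrite addnACA rL' addnACA.
    by have := dL' v; rewrite /outdeg /indeg /=; lia.
  move=> v; have := bL' v; have := dL' v; rewrite /outdeg /indeg /=.
  case/orP: H => [/eqP ->|]; first by lia.
  have [->|ab] := eqVneq a b; first by lia.
  move=> /hasPn H.
  have z (P : pred (T * T)) : (forall p, P p -> [|| p.1 == a, p.2 == a, p.1 == b | p.2 == b]) ->
      count P L = 0.
    move=> PH; apply/eqP; rewrite -leqn0 leqNgt -has_count; apply/negP => /hasP[p pL /PH].
    by rewrite (negbTE (H p pL)).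
  have [<-|av] := eqVneq a v.
    by rewrite [b == a]eq_sym (negbTE ab) !z => [|p ->|p ->]; rewrite ?orbT //; lia.
  have [<-|bv] := eqVneq b v; last by lia.
  by rewrite !z => [|p ->|p ->]; rewrite ?orbT //; lia.
have [|] := boolP ((a == b) || ~~ has (fun p => [|| p.1 == a, p.2 == a, p.1 == b | p.2 == b]) L);
  first exact: ext.
rewrite negb_or negbK => /andP[ab /hasP[[x y] pL /= xy]].
have sz z : size ((z : T * T) :: rem (x, y) L) < m.
  by rewrite /= size_rem //; case: (L) pL sL => //= ? ?; lia.
(* Trade the path a' - b' - c for the edge a' - c, which is one edge less. *)
have step a' b' c : (x, y) = (b', c) \/ (x, y) = (c, b') ->
  exists2 L', reorients ((a', b') :: L) L' & balanced L'.
  move=> pbc; have [M rM bM] := IH ((a', c) :: rem (x, y) L) (sz _).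
  exact: splice_orientation pL pbc rM bM.
have flip : (exists2 L', reorients ((b, a) :: L) L' & balanced L') ->
    exists2 L', reorients ((a, b) :: L) L' & balanced L'.
  by move=> [L'' /reorients_flip]; exists L''.
(* If the shared end is a, the edge is first flipped so that it comes second. *)
case/or4P: xy => /eqP xyE.
- by apply: flip; apply: (step _ _ y); left; rewrite xyE.
- by apply: flip; apply: (step _ _ x); right; rewrite xyE.
- by apply: (step _ _ y); left; rewrite xyE.
- by apply: (step _ _ x); right; rewrite xyE.
Qed.

End Orientation.

Lemma sum_count_pair (T : finType) (L : seq (T * T)) v :
  (\sum_w count_mem (v, w) L = outdeg L v) /\ (\sum_w count_mem (w, v) L = indeg L v).
Proof.
elim: L => [|[a b] L [IH1 IH2]] /=; first by rewrite !big1.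
rewrite !big_split /= IH1 IH2 /outdeg /indeg /=; split; congr (_ + _).
  rewrite (bigD1 b) //= big1 ?addn0 => [|w wb]; first by rewrite xpair_eqE eqxx andbT.
  by rewrite xpair_eqE [b == w]eq_sym (negbTE wb) andbF.
rewrite (bigD1 a) //= big1 ?addn0 => [|w wb]; first by rewrite xpair_eqE eqxx.
by rewrite xpair_eqE [a == w]eq_sym (negbTE wb).
Qed.

(** In- and out-degree differ by at most one and add up to at most d, so that
    neither exceeds the ceiling of d / 2. *)
Lemma balanced_graph_orientation n (e : rel 'I_n) d : symmetric e -> irreflexive e ->
  (forall u, #|[set v | e u v]| <= d) ->
  exists L : seq ('I_n * 'I_n), [/\ uniq L,
    forall a b, ((a, b) \in L) + ((b, a) \in L) = e a b &
    forall v, outdeg L v <= uphalf d /\ indeg L v <= uphalf d].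
Proof.
move=> se ie dd.
pose L := [seq p : 'I_n * 'I_n <- enum {: 'I_n * 'I_n} | (p.1 < p.2) && e p.1 p.2].
have mL (a b : 'I_n) : ((a, b) \in L) = (a < b) && e a b.
  transitivity (((a < b) && e a b) && ((a, b) \in enum {: 'I_n * 'I_n})); first exact: mem_filter.
  by rewrite mem_enum andbT.
have uL0 : uniq L by apply: filter_uniq; apply: enum_uniq.
have [L' [rL _] bL] := balanced_orientation L.
have cL a b : count_mem (a, b) L' + count_mem (b, a) L' = e a b.
  rewrite rL !count_uniq_mem // !mL.
  rewrite [e b a]se; case: (ltngtP a b) => //=; first by rewrite addn0.
  by move/val_inj ->; rewrite ie.
have uL : uniq L'.
  apply: count_mem_uniq => -[a b]; have := cL a b.
  rewrite -has_pred1 has_count; case: (e a b) => /=; case: (count_mem (a, b) L') => //=; lia.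
exists L'; split => // [a b|v]; first by rewrite -cL !count_uniq_mem.
have := dd v; rewrite -sum1_card.
have -> : \sum_(w in [set w | e v w]) 1 = outdeg L' v + indeg L' v.
  have [<- <-] := sum_count_pair L' v; rewrite -big_split /= big_mkcond /=.
  by apply: eq_bigr => w _; rewrite inE cL; case: (e v w).
have := bL v; have := uphalf_half d; have := odd_double_half d; lia.
Qed.

Local Open Scope ring_scope.

(** * Sums of determinants over all signings *)

Section EdgeSets.
Variable n : nat.
Implicit Types (S : {set 'I_n}) (v : 'I_n) (e : 'I_n * 'I_n).

Definition incident v e := (e.1 == v) || (e.2 == v).
Definition inside S e := (e.1 \in S) && (e.2 \in S).
Definition del_edge S e := S :\ e.1 :\ e.2.

Lemma del_edgeC S e f : del_edge (del_edge S e) f = del_edge (del_edge S f) e.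
Proof. by apply/setP=> i; rewrite !inE; do !bool_congr. Qed.

End EdgeSets.

Section Det.
Variables (K : comNzRingType) (n : nat).
Implicit Types (X M : 'M[K]_n) (u v : 'I_n).

Definition set_row X u (r : 'rV[K]_n) : 'M[K]_n :=
  \matrix_(i, j) if i == u then r 0 j else X i j.

Lemma det_add_row X u (r : 'rV[K]_n) c :
  \det (X + c *: (delta_mx u 0 *m r)) = \det X + c * \det (set_row X u r).
Proof.
rewrite -[\det X]mul1r; apply: (@determinant_multilinear _ _ _ _ _ u).
- apply/rowP=> j; rewrite !mxE eqxx big_ord1 !mxE !eqxx !mul1r; by ring.
- apply/matrixP=> i j; rewrite !mxE big_ord1 !mxE eq_sym (negbTE (neq_lift _ _)).
  by rewrite /= mul0r mulr0 addr0.
- apply/matrixP=> i j; rewrite !mxE big_ord1 !mxE eq_sym (negbTE (neq_lift _ _)).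
  by rewrite /= mul0r mulr0 addr0.
Qed.

Lemma det_add_entry X u v c :
  \det (X + c *: delta_mx u v) = \det X + c * \det (set_row X u (delta_mx 0 v)).
Proof. by rewrite -(mul_delta_mx (0 : 'I_1)) det_add_row. Qed.

Lemma det_swap_unit_rows X u v : u != v ->
  \det (set_row (set_row X u (delta_mx 0 v)) v (delta_mx 0 u)) =
  - \det (set_row (set_row X u (delta_mx 0 u)) v (delta_mx 0 v)).
Proof.
move=> uv; set Y := set_row (set_row X u (delta_mx 0 u)) _ _.
have -> : set_row (set_row X u (delta_mx 0 v)) v (delta_mx 0 u) = xrow u v Y.
  apply/matrixP=> i j; rewrite !mxE.
  case: tpermP => [->|->|/eqP iu /eqP iv].
  - by rewrite (negbTE uv) !eqxx.
  - by rewrite (negbTE uv) !eqxx.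
  - by rewrite (negbTE iu) (negbTE iv).
by rewrite xrowE det_mulmx det_perm odd_tperm uv expr1 mulN1r.
Qed.

Definition edge_mx (e : 'I_n * 'I_n) : 'M[K]_n :=
  delta_mx e.1 e.2 + delta_mx e.2 e.1.

(** Resetting the rows outside [S] to unit vectors gives the principal minor on
    [S] without changing the size of the matrix. *)
Definition principal_minor (S : {set 'I_n}) M : K :=
  \det (\matrix_(i, j) if i \in S then M i j else (i == j)%:R).

Lemma principal_minor_setT M : principal_minor setT M = \det M.
Proof. by congr (\det _); apply/matrixP => i j; rewrite !mxE in_setT. Qed.

(** The determinant is affine in each of the two perturbed rows, so that only
    the terms of even degree in the signs survive; the quadratic one is the
    determinant with both rows replaced by unit vectors, up to sign. *)
Lemma det_pm_entries X u v c d : u != v ->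
  \det (X + c *: delta_mx u v + d *: delta_mx v u) +
  \det (X - c *: delta_mx u v - d *: delta_mx v u) =
  (\det X) *+ 2 -
    (c * d * \det (set_row (set_row X u (delta_mx 0 u)) v (delta_mx 0 v))) *+ 2.
Proof.
move=> uv; rewrite -!scaleNr !det_add_entry.
have E b : \det (set_row (X + b *: delta_mx u v) v (delta_mx 0 u)) =
  \det (set_row X v (delta_mx 0 u)) -
    b * \det (set_row (set_row X u (delta_mx 0 u)) v (delta_mx 0 v)).
  have -> : set_row (X + b *: delta_mx u v) v (delta_mx 0 u) =
            set_row X v (delta_mx 0 u) + b *: delta_mx u v.
    apply/matrixP=> i j; rewrite !mxE.
    by case: (i =P v) => [->|//]; rewrite [v == u]eq_sym (negbTE uv) /= mulr0 addr0.
  rewrite det_add_entry -mulrN -(det_swap_unit_rows _ uv); congr (_ + _ * \det _).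
  apply/matrixP=> i j; rewrite !mxE.
  by case: (i =P u) => [->|//]; rewrite (negbTE uv).
by rewrite !E; ring.
Qed.

(** Averaging over the sign of an edge replaces the determinant by the
    difference with the minor where both ends are removed, whatever the
    original entries of [M] there. *)
Lemma principal_minor_pm_edge S M e : e.1 != e.2 ->
  principal_minor S (M - edge_mx e) + principal_minor S (M + edge_mx e) =
  (principal_minor S M) *+ 2 -
   (if inside S e then principal_minor (del_edge S e) M else 0) *+ 2.
Proof.
case: e => u v /= uv; rewrite addrC /principal_minor /inside /del_edge /=.
set X := (\matrix_(i, j) (if i \in S then M i j else _)).
have E (M' : 'M[K]_n) : (\matrix_(i, j) if i \in S then (M + M') i j else (i == j)%:R) =
   X + \matrix_(i, j) if i \in S then M' i j else 0.
  by apply/matrixP=> i j; rewrite !mxE; case: ifP; rewrite ?addr0.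
rewrite !E.
have -> : (\matrix_(i, j) if i \in S then edge_mx (u, v) i j else 0) =
  (u \in S)%:R *: delta_mx u v + (v \in S)%:R *: delta_mx v u.
  apply/matrixP=> i j; rewrite !mxE.
  case: (eqVneq i u) => [->|_]; first rewrite (negbTE uv) /=;
    last case: (eqVneq i v) => [->|_] /=;
  by case: (_ \in S); rewrite ?(mul1r, mul0r, addr0, add0r, mulr0, if_same).
have -> : (\matrix_(i, j) if i \in S then (- edge_mx (u, v)) i j else 0) =
  - ((u \in S)%:R *: delta_mx u v) - (v \in S)%:R *: delta_mx v u.
  apply/matrixP=> i j; rewrite !mxE /=.
  case: (eqVneq i u) => [->|_]; first rewrite (negbTE uv) /=;
    last case: (eqVneq i v) => [->|_] /=;
  by case: (_ \in S); rewrite ?(mul1r, mul0r, addr0, add0r, mulr0, if_same,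
    oppr0, subr0, sub0r, opprD).
rewrite !addrA det_pm_entries //; congr (_ - _ *+ 2).
case: ifP => [/andP[uS vS]|]; last first.
  by move/negbT; rewrite negb_and => /orP[] /negbTE ->; rewrite ?mul0r ?mulr0 ?mul0r.
rewrite uS vS !mul1r; congr (\det _); apply/matrixP=> i j; rewrite !mxE !inE eqxx /=.
by case: (i =P v) => [->|_] /=; [rewrite eq_sym|case: (i =P u) => [->|//]; rewrite eq_sym].
Qed.

(** A sum over the sign vectors of [L], as a recursion on the edges: fixing the
    sign of the first edge is then a definitional step. *)
Fixpoint signsum (f : 'M[K]_n -> K) (L : seq ('I_n * 'I_n)) M : K :=
  if L is e :: L' then signsum f L' (M - edge_mx e) + signsum f L' (M + edge_mx e)
  else f M.

(** The value at [x] of the matching polynomial of the multigraph ([S], [L]). *)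
Fixpoint matching_sum (x : K) (L : seq ('I_n * 'I_n)) (S : {set 'I_n}) : K :=
  if L is e :: L' then
    matching_sum x L' S -
    (if inside S e then matching_sum x L' (del_edge S e) else 0)
  else x ^+ #|S|.

(** The averagings over the signs of two different edges commute, which
    propagates the rule for a single edge through the list. *)
Lemma signsum_principal_minor_cons e L S M : e.1 != e.2 ->
  signsum (principal_minor S) (e :: L) M =
  (signsum (principal_minor S) L M) *+ 2 -
   (if inside S e then signsum (principal_minor (del_edge S e)) L M else 0) *+ 2.
Proof.
move=> neq; elim: L M => [|a L IH] M; first exact: principal_minor_pm_edge.
have step N : signsum (principal_minor S) [:: e, a & L] N =
   signsum (principal_minor S) (e :: L) (N - edge_mx a) +
   signsum (principal_minor S) (e :: L) (N + edge_mx a).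
  rewrite /= ![N - edge_mx e + _]addrAC ![N + edge_mx e + _]addrAC; by ring.
by rewrite step !IH /=; case: ifP => _; ring.
Qed.

(** Godsil and Gutman: the expected characteristic polynomial of a random
    signing is the matching polynomial. *)
Lemma signsum_principal_minor_scalar x L S : all (fun e => e.1 != e.2) L ->
  signsum (principal_minor S) L x%:M = matching_sum x L S *+ 2 ^ size L.
Proof.
elim: L S => [|e L IH] S /=.
  move=> _; rewrite expn0 mulr1n /principal_minor.
  have -> : (\matrix_(i, j) if i \in S then x%:M i j else (i == j)%:R) =
    diag_mx (\row_i if i \in S then x else 1 : K).
    by apply/matrixP=> i j; rewrite !mxE; case: ifP.
  rewrite det_diag (bigID (mem S)) /= [X in _ * X]big1 ?mulr1.
    by rewrite (eq_bigr (fun=> x)) ?prodr_const // => i iS; rewrite mxE iS.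
  by move=> i iS; rewrite mxE (negbTE iS).
case/andP=> neq aL; rewrite -/(signsum _ (e :: L) _) signsum_principal_minor_cons // !IH //.
rewrite expnS mulnC mulrnA.
by case: ifP => _; rewrite -?mulrnBl // !subr0 ?mul0rn ?subr0.
Qed.

End Det.

Section RankOne.
Variables (K : comNzRingType) (n : nat).

Definition rank1_affine (f : 'M[K]_n -> K) := forall M (c : 'cV_n) (r : 'rV_n) t,
  f (M - t *: (c *m r)) = t * f (M - c *m r) + (1 - t) * f M.

(** By a Schur complement, det (M - s c r) is the determinant of a bordered
    matrix in which s scales part of a single row. *)
Lemma det_rank1_affine : rank1_affine (@determinant K n).
Proof.
move=> M c r t.
have E s : \det (M - s *: (c *m r)) = \det (block_mx (1%:M : 'M_1) (s *: r) c M).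
  have -> : block_mx (1%:M : 'M_1) (s *: r) c M =
    block_mx 1%:M 0 c 1%:M *m block_mx 1%:M (s *: r) 0 (M - s *: (c *m r)).
    by rewrite mulmx_block !mul1mx !mul0mx ?mulmx1 ?addr0 -scalemxAr addrC subrK.
  by rewrite det_mulmx det_lblock det_ublock !det1 !mul1r.
have lin s : \det (M - s *: (c *m r)) = \det (block_mx (1%:M : 'M_1) 0 c M) +
    s * \det (set_row (block_mx (1%:M : 'M_1) 0 c M) (lshift n 0) (row_mx 0 r)).
  rewrite E -det_add_row; congr (\det _).
  have -> : delta_mx (lshift n 0) 0 = col_mx 1%:M 0 :> 'M[K]_(1 + n, 1).
    apply/matrixP=> i j; rewrite ord1 !mxE; case: splitP => k ik.
      by rewrite !ord1 !mxE eqxx andbT -val_eqE /= ik ord1.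
    by rewrite mxE andbT -val_eqE /= ik.
  rewrite mul_col_row !mul1mx mulmx0 ?mul0mx scale_block_mx add_block_mx.
  by rewrite !scaler0 !addr0 add0r.
have := lin 1; rewrite scale1r => ->.
by have := lin 0; rewrite scale0r subr0 => ->; rewrite lin; ring.
Qed.

Lemma signsum_rank1_affine f L : rank1_affine f -> rank1_affine (signsum f L).
Proof.
move=> fa; elim: L => [|e L IH] //= M c r t.
by rewrite ![M - _ *m _ + _]addrAC ![M - _ *: _ + _]addrAC !IH; ring.
Qed.

Definition edge_vec (s : K) (e : 'I_n * 'I_n) : 'rV[K]_n :=
  delta_mx 0 e.1 + s *: delta_mx 0 e.2.

(** What must be added to plus or minus [edge_mx e] to get a positive
    semidefinite matrix of rank one. *)
Definition edge_diag (e : 'I_n * 'I_n) : 'M[K]_n :=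
  delta_mx e.1 e.1 + delta_mx e.2 e.2.

Lemma edge_rank1 s e : s ^+ 2 = 1 ->
  (edge_vec s e)^T *m edge_vec s e = edge_diag e + s *: edge_mx K e.
Proof.
move=> s2; rewrite /edge_vec.
have -> : (delta_mx 0 e.1 + s *: delta_mx 0 e.2)^T =
    delta_mx e.1 0 + s *: delta_mx e.2 0 :> 'cV_n.
  by rewrite linearD linearZ /= !trmx_delta.
rewrite mulmxDl !mulmxDr -!scalemxAl -!scalemxAr !mul_delta_mx scalerA -expr2 s2.
by rewrite scale1r /edge_diag /edge_mx scalerDr [X in _ + X = _]addrC addrACA.
Qed.

End RankOne.

Lemma signsum_map (K K' : comNzRingType) (phi : {rmorphism K -> K'}) n L (M : 'M[K]_n) :
  phi (signsum (@determinant K n) L M) = signsum (@determinant K' n) L (map_mx phi M).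
Proof.
elim: L M => [|e L IH] M /=; first by rewrite det_map_mx.
by rewrite rmorphD !IH /edge_mx map_mxB !map_mxD !map_delta_mx.
Qed.

Lemma eq_signsum (K : comNzRingType) n (f g : 'M[K]_n -> K) L M : f =1 g ->
  signsum f L M = signsum g L M.
Proof. by move=> fg; elim: L M => [|e L IH] M /=; rewrite ?fg ?IH. Qed.

(** * The matching polynomial above its roots *)

Section Matching.
Variables (K : comNzRingType) (n : nat) (x : K).
Implicit Types (S : {set 'I_n}) (v : 'I_n) (e : 'I_n * 'I_n) (L : seq ('I_n * 'I_n)).

(** Either the vertex [v] is unmatched, or one of its edges belongs to the
    matching. *)
Lemma matching_sum_vertex L S v : all (fun e => e.1 != e.2) L -> v \in S ->
  matching_sum x L S = x * matching_sum x L (S :\ v) -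
    \sum_(e <- L | incident v e && inside S e) matching_sum x L (del_edge S e).
Proof.
elim: L S => [|e L IH] S /=.
  by rewrite big_nil subr0 => _ vS; rewrite (cardsD1 v S) vS exprS.
case/andP=> neq /[dup] aL /IH{}IH vS.
have msE (T : {set 'I_n}) : v \notin T -> incident v e ->
    matching_sum x (e :: L) T = matching_sum x L T.
  move=> vT /orP[] /eqP ev /=; rewrite /inside ev (negbTE vT) ?andbF ?subr0 //.
rewrite big_cons -/(matching_sum x (e :: L) _).
case: (boolP (incident v e)) => ve /=.
  have vDf f : incident v f -> v \notin del_edge S f.
    by move=> /orP[] /eqP <-; rewrite !inE eqxx ?andbF.
  have -> : inside (S :\ v) e = false.
    by apply/negP; move: ve; rewrite /inside !inE => /orP[] /eqP ->; rewrite eqxx ?andbF.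
  rewrite subr0 (eq_bigr (fun f => matching_sum x L (del_edge S f))); last first.
    by move=> f /andP[vf _]; apply: msE => //; apply: vDf.
  rewrite IH //; case: ifP => eS; last by rewrite subr0.
  rewrite -!/(matching_sum x (e :: L) _) msE //; last exact: vDf.
  by ring.
rewrite /=.
have [eS|eS] := boolP (inside S e); last first.
  have -> : inside (S :\ v) e = false.
    apply: contraNF eS; rewrite /inside !inE.
    by move=> /andP[/andP[_ ->] /andP[_ ->]].
  rewrite !subr0 IH //; congr (_ - _); apply: eq_bigr => f _.
  have -> : inside (del_edge S f) e = false.
    apply: contraNF eS; rewrite /inside /del_edge !inE.
    by move=> /andP[/andP[_ /andP[_ ->]] /andP[_ /andP[_ ->]]].
  by rewrite subr0.
have e1v : (e.1 == v) = false by apply: contraNF ve; rewrite /incident => ->.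
have e2v : (e.2 == v) = false by apply: contraNF ve; rewrite /incident orbC => ->.
have -> : inside (S :\ v) e by move: eS; rewrite /inside !inE e1v e2v.
have vSe : v \in del_edge S e.
  by rewrite !inE ![v == _]eq_sym e1v e2v.
have -> : del_edge (S :\ v) e = del_edge S e :\ v.
  by apply/setP=> i; rewrite !inE; do !bool_congr.
rewrite (IH S) // (IH (del_edge S e)) //.
rewrite [\sum_(_ <- _ | _) (_ - _)]sumrB.
rewrite -[\sum_(_ <- _ | _) (if _ then _ else _)]big_mkcondr /=.
suff -> : \sum_(f <- L | incident v f && inside (del_edge S e) f)
      matching_sum x L (del_edge (del_edge S e) f) =
    \sum_(f <- L | incident v f && inside S f && inside (del_edge S f) e)
      matching_sum x L (del_edge (del_edge S f) e) by ring.
apply: eq_big => f; last by rewrite del_edgeC.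
rewrite -!andbA; congr (_ && _); move: eS; rewrite /inside /del_edge !inE.
case/andP=> -> ->; rewrite ![e.1 == _]eq_sym ![e.2 == _]eq_sym !andbT.
by do 2!case: (_ \in S); do 4!case: (_ == _).
Qed.

End Matching.

Section HeilmannLieb.
Variables (F : realFieldType) (n : nat) (x r : F) (k : nat).
Variable L : seq ('I_n * 'I_n).
Hypothesis Lneq : all (fun e => e.1 != e.2) L.
Hypothesis r1 : 1 <= r.
Hypothesis rk : r ^+ 2 = k%:R.
Hypothesis xr : 2 * r <= x.
Hypothesis degL : forall v, (count (incident v) L <= k.+1)%N.

Definition local_degree (S : {set 'I_n}) v := count (fun e => incident v e && inside S e) L.

Lemma matching_sum0 : matching_sum x L set0 = 1.
Proof.
elim: (L) => [|e l IH] /=; first by rewrite cards0 expr0.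
by rewrite IH /inside inE subr0.
Qed.

(** A vertex that has lost one of its edges has local degree at most [k]; this
    is what makes the induction of Heilmann and Lieb close up. *)
Lemma local_degree_lt S v e : e \in L -> incident v e -> ~~ inside S e ->
  (local_degree S v <= k)%N.
Proof.
move=> eL ve eS; rewrite -ltnS; apply: leq_trans (degL v).
have -> : count (incident v) L = (local_degree S v +
   count (fun f => incident v f && ~~ inside S f) L)%N.
  rewrite /local_degree; elim: (L) => //= f l ->.
  by case: (incident v f); case: (inside S f) => /=; lia.
by rewrite -addn1 leq_add2l -has_count; apply/hasP; exists e => //; rewrite ve.
Qed.

(** With r = sqrt k and x >= 2 r, the ratio m(S) / m(S - v) exceeds r when v has
    at most k neighbours in S.  Indeed it is x minus the sum over the
    neighbours u of m(S - v - u) / m(S - v), where each term is below 1 / r by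
    induction since u has lost the neighbour v.  If v has k + 1 neighbours, the
    same estimate leaves a ratio above x - (k + 1) / r, which is nonnegative
    because r >= 1. *)
Lemma matching_sum_ratio S :
  0 < matching_sum x L S /\
  forall v, v \in S -> (local_degree S v <= k)%N ->
    r * matching_sum x L (S :\ v) < matching_sum x L S.
Proof.
have [m mS] := ubnP #|S|; elim: m S mS => // m IH S mS.
have r0 : 0 < r by apply: lt_le_trans r1; apply: ltr01.
have rr1 : 1 <= r ^+ 2 by rewrite exprn_ege1.
have rxr : 2 * r ^+ 2 <= r * x by rewrite expr2 mulrCA ler_pM2l ?xr.
(* The estimate is strict unless v is isolated, where the sum is empty and the
   claims follow from x >= 2 r > r. *)
have main v : v \in S -> let m' := matching_sum x L (S :\ v) in
   0 < m' /\ ((r * x - (local_degree S v)%:R) * m' < r * matching_sum x L S \/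
     local_degree S v = 0%N /\ r * matching_sum x L S = r * x * m').
  move=> vS m'.
  have cSv : (#|S :\ v| < m)%N by move: mS; rewrite (cardsD1 v S) vS.
  have [m'0 ratio] := IH _ cSv; split=> //.
  rewrite (matching_sum_vertex x Lneq vS) -/m'.
  have [d0|d0] := posnP (local_degree S v).
    right; split => //; rewrite big_hasC ?subr0 ?mulrA //.
    by rewrite has_count -leqNgt leqn0; apply/eqP.
  left; rewrite mulrBr mulrA mulrBl ltrD2l ltrN2 mulr_sumr big_seq_cond /=.
  have -> : (local_degree S v)%:R * m' =
     \sum_(e <- L | (e \in L) && (incident v e && inside S e)) m'.
    by rewrite -big_seq_cond big_const_seq iter_addr_0 mulr_natl.
  apply: ltr_sum.
    apply/hasP; move: d0; rewrite -has_count => /hasP[e eL eP].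
    by exists e => //; apply/andP.
  move=> [a b] /and3P[eL ve eS]; rewrite /m'.
  have /= ab := allP Lneq _ eL.
  move: (ve) (eS) => /orP[/eqP /= av|/eqP /= bv] /andP[/= aS bS].
    rewrite /del_edge /= av; apply: ratio; first by rewrite !inE bS -av eq_sym ab.
    apply: (local_degree_lt eL); rewrite /incident /inside /= ?eqxx ?orbT //.
    by rewrite av !inE eqxx.
  have -> : del_edge S (a, b) = S :\ v :\ a.
    by apply/setP=> i; rewrite !inE bv /=; do !bool_congr.
  apply: ratio; first by rewrite !inE aS -bv ab.
  apply: (local_degree_lt eL); rewrite /incident /inside /= ?eqxx ?orbT //.
  by rewrite bv !inE eqxx andbF.
split.
  have [->|[v vS]] := set_0Vmem S; first by rewrite matching_sum0.
  have [m'0 [lt|[d0 eq]]] := main v vS; rewrite -(pmulr_rgt0 _ r0).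
    apply: le_lt_trans lt; apply: mulr_ge0; last exact: ltW.
    rewrite subr_ge0; apply: (@le_trans _ _ k.+1%:R).
      rewrite ler_nat; apply: leq_trans (degL v); apply: sub_count => e.
      by case/andP.
    by rewrite -natr1 -rk; lra.
  rewrite eq; apply: mulr_gt0 m'0; apply: mulr_gt0 => //.
  by apply: lt_le_trans xr; apply: mulr_gt0.
move=> v vS dk; rewrite -(ltr_pM2l r0).
have [m'0 [lt|[d0 eq]]] := main v vS.
  apply: le_lt_trans lt; rewrite mulrA; apply: ler_wpM2r; first exact: ltW.
  have : (local_degree S v)%:R <= k%:R :> F by rewrite ler_nat.
  rewrite -rk => h; move: h rxr; rewrite !expr2; lra.
rewrite eq mulrA ltr_pM2r // ltr_pM2l //; move: xr r0; lra.
Qed.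

End HeilmannLieb.

(** * Nonvanishing on the upper half space *)

Section Stable.
Variables (R : rcfType) (n : nat).
Local Notation C := R[i].
Local Notation toC := (real_complex R).
Implicit Types (M N : 'M[C]_n) (v : 'rV[C]_n).

Definition conj_tr v : 'cV[C]_n := (map_mx (@conjc R) v)^T.
Definition herm_form M v : C := (v *m M *m conj_tr v) 0 0.
(** The imaginary part of the numerical range is positive.  For symmetric [M]
    this says that the imaginary part of [M] is positive definite; this form
    avoids splitting [M] into real and imaginary parts. *)
Definition upper_half M := forall v, v != 0 -> 0 < complex.Im (herm_form M v).
Definition upper_nonvanishing (f : 'M[C]_n -> C) := forall M, upper_half M -> f M != 0.

Lemma complex_ImD (x y : C) : complex.Im (x + y) = complex.Im x + complex.Im y.
Proof. by case: x; case: y. Qed.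

Lemma herm_formD M N v : herm_form (M + N) v = herm_form M v + herm_form N v.
Proof. by rewrite /herm_form mulmxDr mulmxDl mxE. Qed.

Lemma herm_formZ a M v : herm_form (a *: M) v = a * herm_form M v.
Proof. by rewrite /herm_form -scalemxAr -scalemxAl mxE. Qed.

Lemma det_upper_nonvanishing : upper_nonvanishing (@determinant C n).
Proof.
move=> M uM; apply/negP => /det0P[v v0 vM].
by have := uM v v0; rewrite /herm_form vM mul0mx mxE ltxx.
Qed.

(** A real symmetric matrix is Hermitian, so its form is its own conjugate. *)
Lemma Im_herm_form_real_sym (A : 'M[R]_n) v :
  A^T = A -> complex.Im (herm_form (map_mx toC A) v) = 0.
Proof.
move=> sA; set q := herm_form _ v.
have : conjc q = q.
  rewrite /q /herm_form.
  transitivity ((map_mx (@conjc R) (v *m map_mx toC A *m conj_tr v))^T 0 0).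
    by rewrite !mxE.
  rewrite !map_mxM !trmx_mul.
  have -> : (map_mx (@conjc R) (conj_tr v))^T = v.
    by apply/matrixP=> i j; rewrite !mxE /= conjcK.
  rewrite mulmxA; congr ((_ *m _ *m _) 0 0).
  by rewrite -[in RHS]sA -map_trmx; congr (_^T); apply/matrixP=> i j; rewrite !mxE /= oppr0.
by case: q => a b [] /eqP; rewrite -subr_eq0 => /eqP h /=; lra.
Qed.

Lemma herm_form1_gt0 v : v != 0 -> exists2 p : R, 0 < p & herm_form 1%:M v = toC p.
Proof.
move=> v0; have fE : herm_form 1%:M v = \sum_i `|v 0 i| ^+ 2.
  rewrite /herm_form mulmx1 mxE; apply: eq_bigr => i _.
  by rewrite !mxE sqr_normc.
have f0 : 0 < herm_form 1%:M v.
  rewrite lt_def fE; apply/andP; split; last by apply: sumr_ge0 => i _; rewrite exprn_ge0.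
  apply: contraNneq v0 => /eqP; rewrite psumr_eq0; last by move=> i _; rewrite exprn_ge0.
  move/allP => h; apply/eqP/rowP => i; rewrite mxE.
  by have := h i (mem_index_enum i); rewrite /= sqrf_eq0 normr_eq0 => /eqP.
exists (complex.Re (herm_form 1%:M v)); last by apply/esym/RRe_real/gtr0_real.
by move: f0; rewrite ltcE => /andP[].
Qed.

Lemma upper_half_shift (A : 'M[R]_n) (z : C) : A^T = A -> 0 < complex.Im z ->
  upper_half (map_mx toC A + z%:M).
Proof.
move=> sA z0 v v0; rewrite herm_formD complex_ImD Im_herm_form_real_sym // add0r.
rewrite -scalemx1 herm_formZ.
have [p p0 ->] := herm_form1_gt0 v0.
by case: z z0 => a b /= b0; rewrite mulr0 add0r mulr_gt0.
Qed.

Lemma upper_half_add_real (A : 'M[R]_n) M :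
  A^T = A -> upper_half M -> upper_half (M + map_mx toC A).
Proof.
by move=> sA uM v v0; rewrite herm_formD complex_ImD Im_herm_form_real_sym // addr0 uM.
Qed.

(** The form of w^T w is a squared modulus, as w is real. *)
Lemma upper_half_rank1 (w : 'rV[R]_n) M t : upper_half M -> complex.Im t <= 0 ->
  upper_half (M - t *: map_mx toC (w^T *m w)).
Proof.
move=> uM t0 v v0; rewrite -scaleNr herm_formD complex_ImD herm_formZ.
have -> : herm_form (map_mx toC (w^T *m w)) v = `|(v *m map_mx toC w^T) 0 0| ^+ 2.
  have -> : herm_form (map_mx toC (w^T *m w)) v =
      (v *m map_mx toC w^T) 0 0 * (map_mx toC w *m conj_tr v) 0 0.
    by rewrite /herm_form map_mxM mulmxA -mulmxA mxE big_ord1.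
  rewrite sqr_normc; congr (_ * _).
  rewrite !mxE rmorph_sum; apply: eq_bigr => i _.
  by rewrite !mxE /= rmorphM /= mulrC; congr (_ * _); rewrite /= oppr0.
have := uM v v0; set y := (v *m _) 0 0.
have -> : `|y| ^+ 2 = toC (complex.Re y ^+ 2 + complex.Im y ^+ 2) by rewrite add_Re2_Im2.
have := sqr_ge0 (complex.Re y); have := sqr_ge0 (complex.Im y).
set p := complex.Re y ^+ 2; set q := complex.Im y ^+ 2 => q0 p0.
case: t t0 => a b /= b0; rewrite mulr0 add0r; nra.
Qed.

(** The affine function t |-> f (M - t w^T w) has no zero with Im t <= 0,
    and its zero is 1 / (1 - c) when c is not 1. *)
Lemma rank1_ratio f (w : 'rV[R]_n) M : rank1_affine f -> upper_nonvanishing f ->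
  upper_half M -> let c := f (M - map_mx toC (w^T *m w)) / f M in
  c = 1 \/ 0 < complex.Im c.
Proof.
move=> fa fn uM c; have fM := fn _ uM.
have [->|c1] := eqVneq c 1; [by left|right].
have y0 : 1 - c != 0 by rewrite subr_eq0 eq_sym.
have t0 : 0 < complex.Im (1 - c)^-1.
  rewrite ltNge; apply/negP => /(upper_half_rank1 w uM)/fn.
  rewrite map_mxM fa -map_mxM.
  have -> : f (M - map_mx toC (w^T *m w)) = c * f M by rewrite mulfVK.
  rewrite mulrA -mulrDl mulf_eq0 (negbTE fM) orbF.
  have -> : (1 - c)^-1 * c + (1 - (1 - c)^-1) = 0 by field.
  by rewrite eqxx.
have := mulVf y0; move: t0; set s := (1 - c)^-1; case: c {c1 y0} @s => a b s.
case: s => t1 t2 /= t20 [].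
rewrite !sub0r => e1 e2.
have tb : t2 = b * (t1 ^+ 2 + t2 ^+ 2).
  transitivity (t2 * (t1 * (1 - a) - t2 * - b) - t1 * (t1 * - b + t2 * (1 - a))).
    by rewrite e1 e2; ring.
  by ring.
have s0 : 0 < t1 ^+ 2 + t2 ^+ 2 by apply: ltr_wpDl; rewrite ?sqr_ge0 ?exprn_gt0.
by move: t20; rewrite tb pmulr_lgt0.
Qed.

(** After division by the value at M + [edge_diag], the two terms of the sum
    over one sign are 1 or have positive imaginary part, so that their sum is
    not 0. *)
Lemma signsum_upper_nonvanishing f L :
  rank1_affine f -> upper_nonvanishing f -> upper_nonvanishing (signsum f L).
Proof.
move=> fa fn; elim: L => [|e L IH] //= M uM.
have uN : upper_half (M + map_mx toC (edge_diag R e)).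
  by apply: upper_half_add_real => //; rewrite linearD /= !trmx_delta.
have LF := signsum_rank1_affine L fa.
have E s : s ^+ 2 = 1 -> M + map_mx toC (edge_diag R e) -
    map_mx toC ((edge_vec s e)^T *m edge_vec s e) = M - toC s *: edge_mx _ e.
  move=> s2; rewrite edge_rank1 // [map_mx _ (_ + _ *: _)]map_mxD opprD addrA addrK map_mxZ.
  by rewrite /edge_mx map_mxD !map_delta_mx.
have := rank1_ratio (edge_vec 1 e) LF IH uN.
have := rank1_ratio (edge_vec (-1) e) LF IH uN.
rewrite !E ?sqrrN ?expr1n //= rmorphN rmorph1 scaleN1r opprK scale1r.
have := IH _ uN; set N := signsum _ _ (M + map_mx _ _) => N0.
set a := signsum _ _ _; set b := signsum _ _ _ => ha hb.
suff : b / N + a / N != 0 by rewrite -mulrDl mulf_eq0 negb_or => /andP[].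
move: ha hb; set x := a / N; set y := b / N => hx hy; apply/negP => /eqP xy0.
have /(congr1 (@complex.Im R)) := xy0; rewrite complex_ImD /=.
have [x0|x0] := hx; have [y0|y0] := hy; move: xy0; rewrite ?x0 ?y0 /=;
  try by move: x0 y0; lra.
  by move/eqP; rewrite -mulr2n pnatr_eq0.
all: rewrite ?x0 ?y0 /=; lra.
Qed.

End Stable.

(** * Interlacing through the Wronskian *)

Section PolyPairs.
Variable R : realType.
Implicit Types g k : {poly R}.

Definition wronskian k g : {poly R} := k^`() * g - k * g^`().

(** The Wronskian is the numerator of the derivative of k / g. *)
Lemma poly_ratio_nondecreasing k g a b : a <= b ->
  (forall t, 0 <= (wronskian k g).[t]) ->
  (forall t, a <= t -> 0 < g.[t]) ->
  k.[a] * g.[b] <= k.[b] * g.[a].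
Proof.
move=> ab W g0.
pose f x := k.[x] / g.[x].
have df x : x \in `[a, b] -> is_derive x 1 f ((wronskian k g).[x] / g.[x] ^+ 2).
  rewrite in_itv /= => /andP[/g0 gx _].
  have gx0 : g.[x] != 0 by rewrite gt_eqF.
  have dgx : derivable (horner g) x 1 by exact: derivable_horner.
  have dg : is_derive x 1 (fun y => g.[y]^-1) (- g.[x] ^- 2 *: g^`().[x]).
    apply: DeriveDef; first exact: derivableV.
    by rewrite deriveV // derive.derivE derive1E.
  apply: (is_derive_eq (is_deriveM (is_derive_poly k x) dg)).
  by rewrite /wronskian !hornerE /GRing.scale /=; field.
have := @ger0_derive1_le_cc _ f a b; move=> mono.
have : f a <= f b.
  apply: mono; rewrite ?in_itv /= ?lexx ?ab //.
  - by move=> x xab; case: (df x (subset_itv_oo_cc xab)).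
  - move=> x xab; have [_ ] := df x (subset_itv_oo_cc xab); rewrite derive1E => ->.
    by rewrite divr_ge0 ?sqr_ge0.
  - apply: derivable_within_continuous => x xab; by case: (df x xab).
by rewrite /f ler_pdivrMr ?g0 // mulrAC ler_pdivlMr ?g0.
Qed.

(** Differential form of the statement that the roots of [k] interlace those of
    [g] and lie to their right: then k / g increases between poles.  The
    clause on sizes forces k / g to tend to 1 at infinity. *)
Definition interlaced g k : Prop :=
  [/\ 0 < lead_coef g, (size (g - k)%R < size g)%N & forall t, 0 <= (wronskian k g).[t]].

(** To the right of the roots of [g] the quotient k / g increases towards its
    limit 1. *)
Lemma interlaced_le g k a : interlaced g k ->
  (forall t, a <= t -> 0 < g.[t]) -> k.[a] <= g.[a].
Proof.
move=> [lg sgk W] g0; rewrite leNgt; apply/negP => lt_a.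
have d0 : 0 < k.[a] - g.[a] by rewrite subr_gt0.
(* If k exceeds g at a, the polynomial p has positive leading coefficient, but
   monotonicity of k / g makes it nonpositive to the right of a. *)
pose p := (k.[a] - g.[a]) *: g + g.[a] *: (g - k).
have sp : (size (g.[a] *: (g - k))%R < size ((k.[a] - g.[a]) *: g)%R)%N.
  rewrite [X in (_ < X)%N]size_scale ?gt_eqF //.
  exact: leq_ltn_trans (size_scale_leq _ _) sgk.
have lp : 0 < lead_coef p by rewrite lead_coefDl // lead_coefZ mulr_gt0.
have [N pN] := poly_pinfty_gt_lc lp.
pose b := Num.max N a.
have ab : a <= b by rewrite le_max lexx orbT.
have : 0 < p.[b] by apply: lt_le_trans (pN b _); rewrite // le_max lexx.
rewrite !hornerE; apply/negP; rewrite -leNgt.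
have := poly_ratio_nondecreasing ab W g0; nra.
Qed.

(** k / g increases as long as [g] is positive, so it remains positive. *)
Lemma interlaced_pos g k : interlaced g k ->
  (forall t, 0 <= t -> 0 < g.[t]) -> 0 < k.[0] -> forall t, 0 <= t -> 0 < k.[t].
Proof.
move=> [_ _ W] g0 k0 t t0.
have := poly_ratio_nondecreasing t0 W g0.
have := g0 _ t0; have := g0 _ (lexx 0) => g00 gt le.
by rewrite -(pmulr_lgt0 _ g00); apply: lt_le_trans le; apply: mulr_gt0.
Qed.

Lemma max_root g a : 0 < lead_coef g -> g.[a] <= 0 ->
  exists b, [/\ a <= b, g.[b] = 0 & forall t, b < t -> 0 < g.[t]].
Proof.
move=> lg ga; have g0 : g != 0 by rewrite -lead_coef_eq0 gt_eqF.
have big c : g.[c] <= 0 -> exists2 r, c <= r & root g r.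
  move=> gc; have [N gN] := poly_pinfty_gt_lc lg.
  have cb : c <= Num.max N c by rewrite le_max lexx orbT.
  have gb : 0 < g.[Num.max N c] by apply: lt_le_trans (gN _ _); rewrite // le_max lexx.
  have [|r] := @poly_ivt _ g _ _ cb; first by rewrite gc ltW.
  by move=> /andP[cr _] rr; exists r.
have [r ar rr] := big a ga.
have smax (s : seq R) x : x \in s -> exists2 m, m \in s & forall y, y \in s -> y <= m.
  elim: s x => // x [|z s] IH _ _.
    by exists x; rewrite ?mem_head // => y; rewrite inE => /eqP ->.
  have [m ms mP] := IH z (mem_head _ _).
  have [xm|mx] := leP x m.
    by exists m => [|y]; rewrite in_cons ?ms ?orbT // => /orP[/eqP ->|/mP].
  exists x => [|y]; rewrite in_cons ?eqxx // => /orP[/eqP ->|/mP] //.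
  by move/le_trans; apply; apply: ltW.
have rP y : (y \in rootsR g) = root g y by rewrite -(roots_on_rootsR g0).
have [b bs bP] : exists2 m, m \in rootsR g & forall y, y \in rootsR g -> y <= m.
  by apply: (smax _ r); rewrite rP.
rewrite rP in bs; exists b; split; first by apply: le_trans ar (bP r _); rewrite rP.
  exact/rootP.
move=> t bt; rewrite ltNge; apply/negP => /big[c tc cr].
by have := bP c; rewrite rP cr => /(_ isT); rewrite leNgt (lt_le_trans bt).
Qed.

(** The point [b] is the largest root of [g]: there k <= g = 0 by continuity,
    for all polynomials [k] at once.  That is why the sum of several such [k]
    cannot be positive to the right of [a]. *)
Lemma interlaced_le0_at_root g a : 0 < lead_coef g -> g.[a] <= 0 ->
  exists2 b, a <= b & forall k, interlaced g k -> k.[b] <= 0.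
Proof.
move=> lg /(max_root lg)[b [ab gb gP]]; exists b => // k gk.
rewrite -gb leNgt; apply/negP => lt_b.
have e0 : 0 < (k - g).[b] by rewrite !hornerE subr_gt0.
have [d d0 dP] := poly_cont b (k - g) e0.
have bd : b < b + d / 2 by rewrite ltrDl divr_gt0.
have le : k.[b + d / 2] <= g.[b + d / 2].
  by apply: interlaced_le gk _ => t /(lt_le_trans bd)/gP.
have := dP (b + d / 2); rewrite addrC addKr gtr0_norm ?divr_gt0 //.
have -> : d / 2 < d by lra.
move=> /(_ isT); rewrite ltr_norml => /andP[+ _].
by move: le; rewrite addrC !hornerE; lra.
Qed.

End PolyPairs.

(** * Choosing the signs one edge at a time *)

Section AboveRoots.
Variables (R : realType) (n : nat).
Local Notation C := R[i].
Local Notation toC := (real_complex R).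
Implicit Types (M N : 'M[R]_n) (L : seq ('I_n * 'I_n)) (k g p : {poly R}).

(** Splits the values of [p] on the vertical line through [t] into real and
    imaginary parts, as polynomials in the square of the height. *)
Lemma horner_vertical p t : exists a b : {poly R},
  [/\ a.[0] = p.[t], b.[0] = p^`().[t] &
   forall h, (map_poly toC p).[t +i* h]%C = (a.[h ^+ 2] +i* (h * b.[h ^+ 2]))%C].
Proof.
elim/poly_ind: p => [|p c [a [b [a0 b0 E]]]].
  exists 0, 0; split=> [||h]; rewrite ?deriv0 ?hornerE //.
  by apply/eqP; rewrite rmorph0 eq_complex /= !hornerE ?mulr0 !eqxx.
exists (t *: a - 'X * b + c%:P), (a + t *: b); split => [||h].
- by rewrite !hornerE a0; ring.
- by rewrite derivD derivM derivX derivC !hornerE a0 b0; ring.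
rewrite rmorphD rmorphM /= map_polyX map_polyC /= !hornerE E.
by apply/eqP; rewrite eq_complex /= !hornerE; apply/andP; split; apply/eqP; ring.
Qed.

(** Close to the real point t, the imaginary part of k(z) times the conjugate of
    g(z) is the height of z times the Wronskian at t, up to higher order. *)
Lemma wronskian_ge0 k g :
  (forall z : C, 0 < complex.Im z ->
     0 <= complex.Im ((map_poly toC k).[z] * conjc (map_poly toC g).[z])) ->
  forall t, 0 <= (wronskian k g).[t].
Proof.
move=> H t; have [a [b [a0 b0 E]]] := horner_vertical k t.
have [a' [b' [a'0 b'0 E']]] := horner_vertical g t.
pose p := b * a' - a * b'.
have -> : (wronskian k g).[t] = p.[0] by rewrite !hornerE a0 b0 a'0 b'0.
rewrite leNgt; apply/negP => p0.
have [d d0 dP] : exists2 d, d > 0 & forall y, `|y - 0| < d -> `|p.[y] - p.[0]| < - p.[0].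
  by apply: poly_cont; rewrite oppr_gt0.
(* The estimate lives at the square of the height: any height with
   square below d will do. *)
pose h := Num.sqrt (d / 2).
have d20 : 0 < d / 2 by rewrite divr_gt0.
have h0 : 0 < h by rewrite sqrtr_gt0.
have hd : h ^+ 2 = d / 2 by rewrite sqr_sqrtr ?ltW.
have := dP (h ^+ 2); rewrite subr0 ger0_norm ?sqr_ge0 // hd.
have -> : d / 2 < d by lra.
move=> /(_ isT); rewrite ltr_norml => /andP[_]; rewrite ltrBlDr addNr -hd => ph.
have := H (t +i* h)%C h0; rewrite E E' /= => K.
have : 0 <= h * p.[h ^+ 2].
  apply: le_trans K _; rewrite le_eqVlt; apply/orP; left; apply/eqP.
  by rewrite !hornerE; ring.
by rewrite pmulr_rge0 // leNgt ph.
Qed.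

Definition signsum_poly L M : {poly R} :=
  signsum (@determinant _ n) L (map_mx polyC M + 'X%:M).

(** [M] lies above the roots of the sum of determinants over the signings of
    [L], along the direction of the identity. *)
Definition above_roots L M := forall t, 0 <= t -> 0 < (signsum_poly L M).[t].

Lemma signsum_poly_horner L M t :
  (signsum_poly L M).[t] = signsum (@determinant _ n) L (M + t%:M).
Proof.
rewrite -[LHS]/(horner_eval t _) signsum_map map_mxD map_scalar_mx /= /horner_eval hornerX.
by congr (signsum _ _ (_ + _)); apply/matrixP=> i j; rewrite !mxE /horner_eval hornerC.
Qed.

Lemma signsum_poly_complex L M z :
  (map_poly toC (signsum_poly L M)).[z] = signsum (@determinant _ n) L (map_mx toC M + z%:M).
Proof.
rewrite -[LHS]/(horner_eval z (map_poly toC _)) !signsum_map !map_mxD !map_scalar_mx /=.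
rewrite /horner_eval map_polyX hornerX.
by congr (signsum _ _ (_ + _)); apply/matrixP=> i j; rewrite !mxE /horner_eval map_polyC hornerC.
Qed.

Lemma signsum_poly_cons e L M :
  signsum_poly (e :: L) M =
  signsum_poly L (M - edge_mx R e) + signsum_poly L (M + edge_mx R e).
Proof.
have E : map_mx polyC (edge_mx R e) = edge_mx _ e by rewrite /edge_mx map_mxD !map_delta_mx.
by rewrite /signsum_poly /= map_mxB [map_mx _ (M + _)]map_mxD E addrAC [_ + 'X%:M + _]addrAC.
Qed.

(** Up to the number of signings, these polynomials are monic of degree n. *)
Lemma signsum_poly_lead L M : (size (signsum_poly L M - (2 ^+ size L) *: 'X^n)%R <= n)%N.
Proof.
elim: L M => [|e L IH] M.
  have -> : signsum_poly [::] M = char_poly (- M).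
    by rewrite /signsum_poly /= /char_poly /char_poly_mx map_mxN opprK addrC.
  rewrite expr0 scale1r; apply/leq_sizeP => j nj; rewrite coefB coefXn.
  have := size_char_poly (- M); have := char_poly_monic (- M).
  rewrite monicE lead_coefE => /eqP lc sz; rewrite sz in lc.
  have [->|jn] := eqVneq j n; first by rewrite lc subrr.
  by rewrite nth_default ?sz ?subr0 // ltn_neqAle eq_sym jn.
rewrite signsum_poly_cons /= exprS mulrDl mul1r scalerDl [- (_ *: _ + _)]opprD addrACA.
by apply: leq_trans (size_polyD _ _) _; rewrite geq_max !IH.
Qed.

(** The matrix [M] plus a nonreal scalar is in the upper half space, where
    [rank1_ratio] controls the quotient of the two polynomials. *)
Lemma interlaced_rank1 L M (w : 'rV_n) : M^T = M ->
  interlaced (signsum_poly L M) (signsum_poly L (M - w^T *m w)).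
Proof.
move=> sM; have c0 : (0 : R) < 2 ^+ size L by rewrite exprn_gt0.
have sX : size (2 ^+ size L *: 'X^n : {poly R}) = n.+1.
  by rewrite size_scale ?gt_eqF // size_polyXn.
have E N : signsum_poly L N =
    2 ^+ size L *: 'X^n + (signsum_poly L N - (2 ^+ size L) *: 'X^n).
  by rewrite addrC subrK.
have lt N : (size (signsum_poly L N - (2 ^+ size L) *: 'X^n)%R <
    size (2 ^+ size L *: 'X^n : {poly R})%R)%N.
  by rewrite sX ltnS signsum_poly_lead.
split.
- by rewrite E lead_coefDl // lead_coefZ lead_coefXn mulr1.
- have -> : size (signsum_poly L M) = n.+1 by rewrite E size_polyDl.
  rewrite ltnS.
  rewrite -(subrKA (2 ^+ size L *: 'X^n)) -[_ *: _ - signsum_poly _ _]opprB.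
  apply: leq_trans (size_polyD _ _) _; rewrite geq_max signsum_poly_lead.
  by rewrite size_polyN signsum_poly_lead.
apply: wronskian_ge0 => z z0; rewrite !signsum_poly_complex map_mxB addrAC.
have uM := upper_half_shift sM z0.
have fa := signsum_rank1_affine L (@det_rank1_affine C n).
have fn := signsum_upper_nonvanishing L (@det_rank1_affine C n) (@det_upper_nonvanishing R n).
have := rank1_ratio w fa fn uM; have := fn _ uM.
set a := signsum _ _ _; set b := signsum _ _ _ => a0 h.
(* The second factor is real and nonnegative, so only the sign of Im (b / a)
   matters. *)
have -> : b * conjc a = b / a * (a * conjc a) by rewrite mulrA divfK.
rewrite -sqr_normc -add_Re2_Im2.
have := sqr_ge0 (complex.Re a); have := sqr_ge0 (complex.Im a).
set p := complex.Re a ^+ 2; set q := complex.Im a ^+ 2 => q0 p0.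
case: h => [->|]; first by rewrite mul1r.
case: (b / a) => x y /= y0; rewrite mulr0 add0r; nra.
Qed.

(** The polynomial of N = M + [edge_diag] interlaces the polynomials of both
    choices of sign.  At its largest root to the right of 0, if any, both would
    be nonpositive, although their sum is positive; so N lies above the roots,
    and then so does the choice that is positive at 0. *)
Lemma above_roots_cons e L M : M^T = M -> above_roots (e :: L) M ->
  above_roots L (M - edge_mx R e) \/ above_roots L (M + edge_mx R e).
Proof.
move=> sM cM; pose N := M + edge_diag R e.
have sN : N^T = N.
  have sD : (edge_diag R e)^T = edge_diag R e by rewrite linearD /= !trmx_delta.
  by rewrite linearD /= sM sD.
have E s : s ^+ 2 = 1 -> N - (edge_vec s e)^T *m edge_vec s e = M - s *: edge_mx _ e.
  by move=> s2; rewrite edge_rank1 // opprD addrA addrK.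
have kp := interlaced_rank1 L (edge_vec 1 e) sN.
have km := interlaced_rank1 L (edge_vec (-1) e) sN.
rewrite !E ?sqrrN ?expr1n // in kp km.
rewrite scale1r in kp; rewrite scaleN1r opprK in km.
have g0 t : 0 <= t -> 0 < (signsum_poly L N).[t].
  move=> t0; rewrite ltNge; apply/negP => gt.
  have [lg _ _] := kp.
  have [b tb kb] := interlaced_le0_at_root lg gt.
  have := cM b (le_trans t0 tb); rewrite signsum_poly_cons hornerD.
  by have := kb _ kp; have := kb _ km; lra.
have := cM 0 (lexx 0); rewrite signsum_poly_cons hornerD => s0.
have [p0|p0] := ltP 0 (signsum_poly L (M - edge_mx R e)).[0].
  by left; apply: interlaced_pos kp g0 p0.
by right; apply: interlaced_pos km g0 _; lra.
Qed.

Definition signed_sum (s : 'I_n * 'I_n -> bool) L : 'M[R]_n :=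
  \sum_(e <- L) (-1) ^+ s e *: edge_mx R e.

Lemma above_roots_signing L M : uniq L -> M^T = M -> above_roots L M ->
  exists s, above_roots [::] (M - signed_sum s L).
Proof.
elim: L M => [|e L IH] M; first by exists xpred0; rewrite /signed_sum big_nil subr0.
case/andP=> eL uL sM cM.
have [b cb] : exists b : bool, above_roots L (M - (-1) ^+ b *: edge_mx R e).
  have [h|h] := above_roots_cons sM cM; [exists false|exists true].
    by rewrite expr0 scale1r.
  by rewrite expr1 scaleN1r opprK.
have [|s cs] := IH _ uL _ cb.
  rewrite linearB /= linearZ /= sM; congr (_ - _ *: _).
  by rewrite linearD /= !trmx_delta addrC.
exists (fun f => if f == e then b else s f).
rewrite /signed_sum big_cons eqxx opprD addrA.
rewrite (eq_big_seq (fun f => (-1) ^+ s f *: edge_mx R f)) // => f fL.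
by case: eqP fL eL => // -> ->.
Qed.

(** If v M v^T = q < 0, adding to M the rank one matrix
    (v M)^T (v M) / (- q) produces a matrix with v in its kernel.  But a rank
    one positive semidefinite perturbation keeps M above the roots of the
    determinant, by interlacing. *)
Lemma above_roots_psd M (v : 'rV_n) : M^T = M -> above_roots [::] M ->
  0 <= (v *m M *m v^T) 0 0.
Proof.
move=> sM cM; rewrite leNgt; apply/negP => q0.
set q := (v *m M *m v^T) 0 0 in q0.
pose w := (Num.sqrt (- q))^-1 *: (v *m M).
have s2 : (Num.sqrt (- q))^-1 * (Num.sqrt (- q))^-1 = (- q)^-1.
  by rewrite -expr2 exprVn sqr_sqrtr // oppr_ge0 ltW.
have wE : w^T *m w = (- q)^-1 *: ((v *m M)^T *m (v *m M)).
  by rewrite /w [(_ *: _)^T]linearZ /= -scalemxAl -scalemxAr scalerA s2.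
have vN : v *m (M + w^T *m w) = 0.
  rewrite mulmxDr wE -scalemxAr trmx_mul sM !mulmxA.
  rewrite -[v *m M *m v^T *m v *m M]mulmxA [v *m M *m v^T]mx11_scalar -/q mul_scalar_mx.
  by rewrite scalerA invrN mulNr mulVf ?lt_eqF // scaleN1r subrr.
have sN : (M + w^T *m w)^T = M + w^T *m w.
  by rewrite linearD /= sM trmx_mul trmxK.
have := interlaced_rank1 [::] w sN; rewrite addrK => kp.
have g0 : (signsum_poly [::] (M + w^T *m w)).[0] <= 0.
  rewrite signsum_poly_horner /= raddf0 addr0 le_eqVlt; apply/orP; left.
  apply/det0P; exists v => //; apply: contraTneq q0 => v0.
  by rewrite /q v0 !mul0mx mxE ltxx.
have [lg _ _] := kp; have [b b0 /(_ _ kp)] := interlaced_le0_at_root lg g0.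
by rewrite leNgt cM.
Qed.

End AboveRoots.

(** * From the bipartite double cover to the graph *)

Lemma edge_form (K : comNzRingType) n (v : 'rV[K]_n) e :
  (v *m edge_mx K e *m v^T) 0 0 = (v 0 e.1 * v 0 e.2) *+ 2.
Proof.
have E i j : (v *m delta_mx i j *m v^T) 0 0 = v 0 i * v 0 j.
  rewrite -(mul_delta_mx (0 : 'I_1)) mulmxA -mulmxA mxE big_ord1 -colE -rowE.
  by rewrite !mxE.
by rewrite /edge_mx mulmxDr mulmxDl mxE !E [v 0 e.2 * _]mulrC.
Qed.

Lemma signed_sum_form (R : realType) n (s : 'I_n * 'I_n -> bool) L (v : 'rV[R]_n) :
  (v *m signed_sum R s L *m v^T) 0 0 = \sum_(e <- L) (-1) ^+ s e * (v 0 e.1 * v 0 e.2) *+ 2.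
Proof.
rewrite /signed_sum mulmx_sumr mulmx_suml summxE; apply: eq_bigr => e _.
by rewrite -scalemxAr -scalemxAl mxE edge_form mulrnAr.
Qed.

(** Only the largest eigenvalue is bounded here; for bipartite graphs the
    symmetry of the spectrum takes care of the smallest one. *)
Lemma bounded_degree_signing (R : realType) n (L : seq ('I_n * 'I_n)) k :
  (0 < k)%N -> uniq L -> all (fun e => e.1 != e.2) L ->
  (forall v, (count (incident v) L <= k.+1)%N) ->
  exists s, forall v : 'rV[R]_n,
    (v *m signed_sum R s L *m v^T) 0 0 <=
    2 * Num.sqrt k%:R * (v *m v^T) 0 0.
Proof.
move=> k0 uL neqL degL; set r : R := Num.sqrt k%:R; pose l := 2 * r.
have r1 : 1 <= r by have := @ler_wsqrtr R 1 k%:R; rewrite sqrtr1; apply; rewrite ler1n.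
have rk : r ^+ 2 = k%:R by rewrite sqr_sqrtr.
have [|s sP] := above_roots_signing uL (tr_scalar_mx n l).
  move=> t t0; rewrite signsum_poly_horner -raddfD.
  rewrite -(eq_signsum _ _ (@principal_minor_setT R n)) signsum_principal_minor_scalar //.
  rewrite pmulrn_lgt0 ?expn_gt0 //.
  have lt : 2 * r <= l + t by rewrite lerDl.
  by have [] := matching_sum_ratio neqL r1 rk lt degL setT.
exists s => v.
have := above_roots_psd v _ sP.
rewrite mulmxBr mulmxBl mul_mx_scalar -scalemxAl !mxE subr_ge0; apply.
rewrite linearB /= tr_scalar_mx; congr (_ - _).
rewrite /signed_sum linear_sum; apply: eq_bigr => e _.
by rewrite linearZ /= linearD /= !trmx_delta addrC.
Qed.

Section Double.
Variables (R : realType) (n : nat).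
Implicit Types (L : seq ('I_n * 'I_n)).

Definition double_edge (p : 'I_n * 'I_n) : 'I_(n + n) * 'I_(n + n) :=
  (lshift n p.1, rshift n p.2).

Lemma double_edge_inj : injective double_edge.
Proof.
move=> [a b] [c d] [/eqP + /eqP]; rewrite eqn_add2l.
by move=> /eqP/val_inj -> /eqP/val_inj ->.
Qed.

(** In the bipartite double cover of the oriented graph, the form at (v, c v)
    is c times the form of the signed adjacency matrix at v, for c = 1 or -1;
    this turns a bound on the largest eigenvalue into a bound on the absolute
    values. *)
Lemma oriented_signing L k : (0 < k)%N -> uniq L ->
  (forall v, (outdeg L v <= k.+1)%N /\ (indeg L v <= k.+1)%N) ->
  exists s, forall v : 'rV[R]_n,
    `|(v *m signed_sum R s L *m v^T) 0 0| <=
    4 * Num.sqrt k%:R * (v *m v^T) 0 0.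
Proof.
move=> k0 uL degL; pose D := map double_edge L.
have [||v|s sP] := @bounded_degree_signing R _ D k k0.
- by rewrite map_inj_uniq //; apply: double_edge_inj.
- by apply/allP => _ /mapP[p _ ->]; rewrite /= eq_lrshift.
- rewrite count_map; case: (split_ordP v) => u ->; have [du iu] := degL u.
    apply: leq_trans du; apply: sub_count => p.
    by rewrite /incident /= eq_lshift eq_rlshift orbF.
  apply: leq_trans iu; apply: sub_count => p.
  by rewrite /incident /= eq_rshift eq_lrshift.
exists (s \o double_edge) => v.
have F c : c ^+ 2 = 1 -> c * (v *m signed_sum R (s \o double_edge) L *m v^T) 0 0 <=
   4 * Num.sqrt k%:R * (v *m v^T) 0 0.
  move=> c2; have := sP (row_mx v (c *: v)).
  rewrite !signed_sum_form big_map /=.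
  rewrite tr_row_mx mul_row_col linearZ /= -scalemxAl -scalemxAr scalerA -expr2 c2 scale1r mxE.
  set a := \sum_(j <- L) _; set b := \sum_(j <- L) _.
  have -> : a = c * b.
    rewrite mulr_sumr; apply: eq_bigr => e _; rewrite row_mxEl row_mxEr mxE; ring.
  lra.
have := F 1; have := F (-1); rewrite sqrrN expr1n !mul1r mulN1r => /(_ erefl) h1 /(_ erefl) h2.
by rewrite ler_norml; apply/andP; split; lra.
Qed.

End Double.

Lemma sum_uniq_delta (R : pzRingType) (I : eqType) (s : seq I) (F : I -> R) a : uniq s ->
  \sum_(x <- s) F x * (x == a)%:R = (a \in s)%:R * F a.
Proof.
elim: s => [|x s IH] /=; first by rewrite big_nil mul0r.
case/andP=> xs us; rewrite big_cons IH // inE eq_sym.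
case: eqP => [->|_] /=; last by rewrite mulr0 add0r.
by rewrite (negbTE xs) mul0r addr0 mulr1 mul1r.
Qed.

Lemma signed_sum_entry (R : realType) n (s : 'I_n * 'I_n -> bool) L i j : uniq L ->
  signed_sum R s L i j =
  ((i, j) \in L)%:R * (-1) ^+ s (i, j) + ((j, i) \in L)%:R * (-1) ^+ s (j, i).
Proof.
move=> uL; rewrite -!(sum_uniq_delta (fun x => (-1) ^+ s x)) // -big_split summxE /=.
apply: eq_bigr => -[a b] _; rewrite !mxE /= mulrDr !xpair_eqE.
by rewrite ![i == _]eq_sym ![j == _]eq_sym [(b == i) && _]andbC.
Qed.

Lemma spectral_radius_le (R : realType) n (A : 'M[R]_n) b : 0 <= b ->
  (forall v : 'rV_n, `|(v *m A *m v^T) 0 0| <= b * (v *m v^T) 0 0) ->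
  spectral_radius A <= b.
Proof.
move=> b0 H; rewrite /spectral_radius big_seq_cond.
apply: bigmax_le => // a /andP[+ _]; rewrite mem_eigenvalues => /eigenvalueP[v vA v0].
have vv : 0 < (v *m v^T) 0 0.
  rewrite mxE lt_def; apply/andP; split; last first.
    by apply: sumr_ge0 => i _; rewrite mxE -expr2 sqr_ge0.
  apply: contraNneq v0 => /eqP; rewrite psumr_eq0; last first.
    by move=> i _; rewrite mxE -expr2 sqr_ge0.
  move/allP => h; apply/eqP/rowP => i; rewrite mxE.
  by have := h i (mem_index_enum i); rewrite mxE -expr2 sqrf_eq0 => /eqP.
have := H v; rewrite vA -scalemxAl mxE normrM (gtr0_norm vv).
by rewrite ler_pM2r.
Qed.

Lemma eq_set2_pair (T : finType) (a b c d : T) : [set a; b] = [set c; d] ->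
  (a, b) = (c, d) \/ (a, b) = (d, c).
Proof.
move=> E.
have := set21 a b; have := set22 a b; rewrite E !inE.
have := set21 c d; have := set22 c d; rewrite -E !inE.
by do 4!case/orP=> /eqP ?; subst; by [left|right].
Qed.

Theorem theorem1p2 (R : realType) (T : finType) (e : rel T) (d : nat) :
  (* uphalf d is the ceiling of d / 2 *)
  simple_graph e -> max_degree e = d -> (3 <= d)%N ->
  exists sigma : {set T} -> int,
    signing e sigma /\
    spectral_radius (signed_adjacency e R sigma)
      <= 4 * Num.sqrt ((uphalf d)%:R - 1) /\
    spectral_radius (signed_adjacency e R sigma)
      <= 2 * Num.sqrt (2 * (d%:R - 1)).
Proof.
move=> [se ie] dE d3.
pose f (i j : 'I_#|T|) := e (enum_val i) (enum_val j).
have degf u : (#|[set v | f u v]| <= d)%N.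
  rewrite -dE; apply: leq_trans (leq_bigmax (enum_val u)).
  rewrite /degree -(card_imset _ enum_val_inj); apply: subset_leq_card.
  by apply/subsetP => _ /imsetP[v fv ->]; rewrite !inE in fv *.
have sf : symmetric f by move=> i j; apply: se.
have rf : irreflexive f by move=> i; apply: ie.
have [L [uL fL dL]] := balanced_graph_orientation sf rf degf.
pose k := (uphalf d).-1.
have kE : uphalf d = k.+1 by rewrite /k prednK // uphalf_gt0; lia.
have k0 : (0 < k)%N by rewrite /k uphalf_half; have := odd_double_half d; lia.
have [|s sP] := @oriented_signing R _ L k k0 uL; first by move=> v; rewrite -kE.
pose ends (p : 'I_#|T| * 'I_#|T|) := [set enum_val p.1; enum_val p.2].
(* An edge inherits the sign of the arc that was chosen for it. *)
pose sigma (E : {set T}) : int := if has (fun p => s p && (ends p == E)) L then -1 else 1.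
have AE : signed_adjacency e R sigma = signed_sum R s L.
  have sE p : p \in L -> sigma (ends p) = (-1) ^+ s p.
    move=> pL; rewrite /sigma; case: hasP => [[q qL /andP[sq /eqP]]|H].
      case: p q {sq} pL qL (sq) => [a b] [c d'] pL qL sq /=.
      case/eq_set2_pair=> [] [/enum_val_inj ca /enum_val_inj db].
        by rewrite -ca -db sq.
      have := fL a b; rewrite pL -{1}ca -{1}db qL; by case: (f a b).
    by case sp: (s p) => //; case: H; exists p; rewrite ?sp /=.
  apply/matrixP => i j; rewrite signed_sum_entry // !mxE -/(f i j).
  have := fL i j; case: (f i j) => /=.
    case ij: ((i, j) \in L); case ji: ((j, i) \in L) => //= _.
      rewrite mul1r mul0r addr0 (sE _ ij : sigma [set _; _] = _).
      by rewrite rmorphXn /= rmorphN1.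
    rewrite mul1r mul0r add0r setUC (sE _ ji : sigma [set _; _] = _).
    by rewrite rmorphXn /= rmorphN1.
  by case: (_ \in L); case: (_ \in L) => // _; rewrite !mul0r addr0.
have main : spectral_radius (signed_adjacency e R sigma) <= 4 * Num.sqrt ((uphalf d)%:R - 1).
  have -> : (uphalf d)%:R - 1 = k%:R :> R by rewrite kE -natr1 addrK.
  rewrite AE; apply: spectral_radius_le sP.
  by rewrite mulr_ge0 // sqrtr_ge0.
exists sigma; split; first by move=> E _; rewrite /sigma; case: ifP; [left|right].
split=> //; apply: le_trans main _.
have -> : 4 * Num.sqrt ((uphalf d)%:R - 1) = 2 * Num.sqrt (4 * ((uphalf d)%:R - 1)) :> R.
  rewrite sqrtrM // (_ : 4 = 2 ^+ 2) ?sqrtr_sqr ?ger0_norm //; by ring.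
rewrite ler_pM2l //; apply: ler_wsqrtr.
have : (2 * uphalf d)%:R <= (d + 1)%:R :> R.
  by rewrite ler_nat uphalf_half; have := odd_double_half d; lia.
by rewrite natrM natrD; lra.
Qed.
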